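(* With each generalized heap $(X,\{\})$ we can associate an equivalence bimodule $$(XX^{-1},\,X^{-1}X,\,X,\,\langle-,-\rangle,\,[-,-]),$$ where $XX^{-1}$ and $X^{-1}X$ are the inverse semigroups constructed from $(X,\{\})$ (with pseudoproduct as multiplication), the left action of $XX^{-1}$ and the right action of $X^{-1}X$ on $X$ are $$xy^{-1}\cdot z=\{xyz\},\qquad x\cdot y^{-1}z=\{xyz\},$$ and $$\langle x,y\rangle=\{xyy\}\{yxx\}^{-1},\qquad [x,y]=\{yyx\}^{-1}\{xxy\}\qquad(x,y\in X).$$
   Context: Generalized heap: a set $X$ with a (total) ternary operation $(x,y,z)\mapsto\{xyz\}$ satisfying, for all elements: (A1) $\{xxx\}=x$; (A2) $\{\{x_1x_2x_3\}x_4x_5\}=\{x_1\{x_4x_3x_2\}x_5\}=\{x_1x_2\{x_3x_4x_5\}\}$; (A3) $\{xx\{yyz\}\}=\{yy\{xxz\}\}$; (A4) $\{\{zxx\}yy\}=\{\{zyy\}xx\}$. Semilattices $E,F$ and maps $p,q$: put $x\circ y=\{xxy\}$ and $x\bullet y=\{xyy\}$. Then $(X,\circ)$ is a right normal band (idempotent semigroup with $xyz=yxz$) and $(X,\bullet)$ is a left normal band (idempotent semigroup with $xyz=xzy$). Green's relation $\mathcal R$ on $(X,\circ)$ and Green's relation $\mathcal L$ on $(X,\bullet)$ are semilattice congruences; $E=(X,\circ)/\mathcal R$, $F=(X,\bullet)/\mathcal L$, and $p\colon X\to E$, $q\colon X\to F$ are the natural maps. Thus $p(x)=p(y)$ iff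 $x=\{yyx\}$ and $y=\{xxy\}$; $q(x)=q(y)$ iff $x=\{xyy\}$ and $y=\{yxx\}$. The inverse semigroup $X^{-1}X$: on the set of pairs $(x,y)\in X\times X$ with $p(x)=p(y)$ put $(x,y)\equiv(u,v)$ iff $q(x)=q(u)$, $q(y)=q(v)$ and $y=\{xuv\}$; this is an equivalence relation. Write $x^{-1}y$ for the class of $(x,y)$ and $X^{-1}X$ for the set of classes. The multiplication (pseudoproduct) is $x^{-1}y\otimes u^{-1}v=\{\{yuu\}yx\}^{-1}\{yuv\}$; the inverse of $x^{-1}y$ is $y^{-1}x$. The inverse semigroup $XX^{-1}$ (dual construction): on the set of pairs $(x,y)$ with $q(x)=q(y)$ put $(x,y)\equiv(u,v)$ iff $p(x)=p(u)$, $p(y)=p(v)$ and $x=\{uvy\}$; this is an equivalence relation. Write $xy^{-1}$ for the class of $(x,y)$ and $XX^{-1}$ for the set of classes. The multiplication (pseudoproduct) is $xy^{-1}\otimes uv^{-1}=\{xyu\}\{vu\{yyu\}\}^{-1}$; the inverse of $xy^{-1}$ is $yx^{-1}$. Modules: for an inverse semigroup $S$, a left $S$-module is a set $X$ with a map $S\times X\to X$, $(s,x)\mapsto sx$, such that $(st)x=s(tx)$ and which is unitary: $SX=X$. Right modules are defined dually. An $(S,T)$-bimodule is a left $S$-module and right $T$-module $X$ with $(sx)t=s(xt)$ for all $s\in S$, $t\in T$, $x\in X$. Equivalence bimodule: for inverse semigroups $S,T$, an equivalence bimodule $(S,T,X,\langle-,-\rangle,[-,-])$ is an $(S,T)$-bimodule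 $X$ with surjective functions $\langle-,-\rangle\colon X\times X\to S$ and $[-,-]\colon X\times X\to T$ such that for all $x,y,z\in X$, $s\in S$, $t\in T$: (MC1) $\langle sx,y\rangle=s\langle x,y\rangle$; (MC2) $\langle y,x\rangle=\langle x,y\rangle^{-1}$; (MC3) $\langle x,x\rangle x=x$; (MC4) $[x,yt]=[x,y]t$; (MC5) $[x,y]=[y,x]^{-1}$; (MC6) $x[x,x]=x$; (MC7) $\langle x,y\rangle z=x[y,z]$. *)

(* Defs.v *)
From HB Require Import structures.
From mathcomp Require Import all_boot generic_quotient.
From mathcomp Require Import monoid boolp classical_sets.

Set Implicit Arguments.
Unset Strict Implicit.
Unset Printing Implicit Defensive.

Import Algebra.

Local Open Scope classical_set_scope.
Local Open Scope quotient_scope.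

HB.mixin Record isGeneralizedHeap (X : Type) := {
  heap_op : X -> X -> X -> X;
  heap_xxx : forall x, heap_op x x x = x;
  heap_assocl : forall a b c d e,
    heap_op (heap_op a b c) d e = heap_op a (heap_op d c b) e;
  heap_assocr : forall a b c d e,
    heap_op a (heap_op d c b) e = heap_op a b (heap_op c d e);
  heap_commL : forall x y z,
    heap_op x x (heap_op y y z) = heap_op y y (heap_op x x z);
  heap_commR : forall x y z,
    heap_op (heap_op z x x) y y = heap_op (heap_op z y y) x x
}.

#[short(type="generalizedHeapType")]
HB.structure Definition GeneralizedHeap := {X of isGeneralizedHeap X}.

Notation "{[ x , y , z ]}" := (heap_op x y z)
  (at level 0, x at level 99, y at level 99, z at level 99,
   format "{[ x ,  y ,  z ]}").

(* [t] is an inverse of [s] when [s t s = s] and [t s t = t]; every element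
   has exactly one. The operations [x^-1] of monoid.v are not reused: they
   presuppose a distinguished element [1]. *)
HB.mixin Record Semigroup_isInverse S of Semigroup S := {
  sinv : S -> S;
  sinvP : forall s t : S, (s * t * s = s /\ t * s * t = t)%g <-> t = sinv s
}.

#[short(type="inverseSemigroupType")]
HB.structure Definition InverseSemigroup :=
  {S of Semigroup_isInverse S & Semigroup S}.

Section Modules.
Local Open Scope group_scope.

Definition left_module (S : semigroupType) (X : Type) (act : S -> X -> X) :=
  (forall s t x, act (s * t) x = act s (act t x)) /\
  (forall x, exists s y, act s y = x).

Definition right_module (T : semigroupType) (X : Type) (act : X -> T -> X) :=
  (forall x s t, act x (s * t) = act (act x s) t) /\
  (forall x, exists y t, act y t = x).

Definition bimodule (S T : semigroupType) (X : Type)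
    (actl : S -> X -> X) (actr : X -> T -> X) :=
  [/\ left_module actl, right_module actr
    & forall s x t, actr (actl s x) t = actl s (actr x t)].

Record equivalence_bimodule (S T : inverseSemigroupType) (X : Type)
    (actl : S -> X -> X) (actr : X -> T -> X)
    (bra : X -> X -> S) (ket : X -> X -> T) : Prop := EquivalenceBimodule {
  eqbm_bimodule : bimodule actl actr;
  eqbm_bra_surj : forall s, exists x y, bra x y = s;
  eqbm_ket_surj : forall t, exists x y, ket x y = t;
  eqbm_MC1 : forall s x y, bra (actl s x) y = s * bra x y;
  eqbm_MC2 : forall x y, bra y x = sinv (bra x y);
  eqbm_MC3 : forall x, actl (bra x x) x = x;
  eqbm_MC4 : forall x y t, ket x (actr y t) = ket x y * t;
  eqbm_MC5 : forall x y, ket x y = sinv (ket y x);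
  eqbm_MC6 : forall x, actr x (ket x x) = x;
  eqbm_MC7 : forall x y z, actl (bra x y) z = actr x (ket y z)
}.

End Modules.

Section Green.
Variables (T : Type) (op : T -> T -> T).

Definition principal_right_ideal (x : T) : set T := [set x] `|` range (op x).
Definition principal_left_ideal (x : T) : set T := [set x] `|` range (op^~ x).

Definition greenR : rel {classic T} :=
  fun x y => `[< principal_right_ideal x = principal_right_ideal y >].
Definition greenL : rel {classic T} :=
  fun x y => `[< principal_left_ideal x = principal_left_ideal y >].

Lemma greenR_refl : reflexive greenR. Proof. by move=> x; apply/asboolP. Qed.
Lemma greenR_sym : symmetric greenR.
Proof. by move=> x y; apply/asboolP/asboolP => ->. Qed.
Lemma greenR_trans : transitive greenR.
Proof. by move=> y x z /asboolP xy /asboolP yz; apply/asboolP; rewrite xy. Qed.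
Canonical greenR_equiv := EquivRel greenR greenR_refl greenR_sym greenR_trans.

Lemma greenL_refl : reflexive greenL. Proof. by move=> x; apply/asboolP. Qed.
Lemma greenL_sym : symmetric greenL.
Proof. by move=> x y; apply/asboolP/asboolP => ->. Qed.
Lemma greenL_trans : transitive greenL.
Proof. by move=> y x z /asboolP xy /asboolP yz; apply/asboolP; rewrite xy. Qed.
Canonical greenL_equiv := EquivRel greenL greenL_refl greenL_sym greenL_trans.

End Green.

Section Semilattices.
Variable X : generalizedHeapType.
Implicit Types x y z : X.

Definition circ x y : X := {[x, x, y]}.
Definition bullet x y : X := {[x, y, y]}.

Definition heapE := {eq_quot greenR_equiv circ}.
Definition heapF := {eq_quot greenL_equiv bullet}.
Definition p (x : X) : heapE := \pi_heapE (x : {classic X}).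
Definition q (x : X) : heapF := \pi_heapF (x : {classic X}).

Lemma heapA a b c d e : {[{[a, b, c]}, d, e]} = {[a, b, {[c, d, e]}]} :> X.
Proof. by rewrite heap_assocl heap_assocr. Qed.

Lemma heapB a b c d e : {[a, {[b, c, d]}, e]} = {[a, d, {[c, b, e]}]} :> X.
Proof. by rewrite heap_assocr. Qed.

Lemma heap_xxxl x y z : {[x, x, {[x, y, z]}]} = {[x, y, z]}.
Proof. by rewrite -heapA heap_xxx. Qed.

Lemma heap_xxxr x y z : {[x, y, {[y, y, z]}]} = {[x, y, z]}.
Proof. by rewrite -heapB heap_xxx. Qed.

Lemma heap_commR' x y z :
  {[z, x, {[x, y, y]}]} = {[z, y, {[y, x, x]}]}.
Proof. by rewrite -!heapA heap_commR. Qed.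

Lemma heap_commM x y z u v :
  {[z, x, {[x, y, {[y, u, v]}]}]} = {[z, y, {[y, x, {[x, u, v]}]}]}.
Proof. by rewrite -!heapA heap_commR. Qed.

Lemma heap_commLL a b c d z :
  {[a, a, {[b, b, {[c, c, {[d, d, z]}]}]}]} =
  {[c, c, {[d, d, {[a, a, {[b, b, z]}]}]}]} :> X.
Proof.
by rewrite (heap_commL b c) (heap_commL b d) (heap_commL a c) (heap_commL a d).
Qed.

Lemma heap_commRR a b c d z :
  {[{[{[{[z, a, a]}, b, b]}, c, c]}, d, d]} =
  {[{[{[{[z, c, c]}, d, d]}, a, a]}, b, b]} :> X.
Proof.
by rewrite (heap_commR b c) (heap_commR b d) (heap_commR a c) (heap_commR a d).
Qed.

Lemma heap_idL x z : {[x, x, {[x, x, z]}]} = {[x, x, z]}.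
Proof. exact: heap_xxxl. Qed.

Lemma pP x y : p x = p y <-> x = {[y, y, x]} /\ y = {[x, x, y]}.
Proof.
split=> [/eqmodP/asboolP xy|[xy yx]].
  have xR : principal_right_ideal circ y x by rewrite -xy; left.
  have yR : principal_right_ideal circ x y by rewrite xy; left.
  split; last by case: yR => [->|[b _ <-]]; rewrite /circ ?heap_xxx ?heap_idL.
  by case: xR => [->|[b _ <-]]; rewrite /circ ?heap_xxx ?heap_idL.
apply/eqmodP/asboolP; rewrite predeqE => z; split=> -[->|[a _ <-]].
- by right; exists x.
- by right; exists {[x, x, a]} => //; rewrite /circ -heapA -xy.
- by right; exists y.
- by right; exists {[y, y, a]} => //; rewrite /circ -heapA -yx.
Qed.

Lemma qP x y : q x = q y <-> x = {[x, y, y]} /\ y = {[y, x, x]}.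
Proof.
split=> [/eqmodP/asboolP xy|[xy yx]].
  have xL : principal_left_ideal bullet y x by rewrite -xy; left.
  have yL : principal_left_ideal bullet x y by rewrite xy; left.
  have id z t : {[{[z, t, t]}, t, t]} = {[z, t, t]} :> X.
    by rewrite heapA heap_xxx.
  split; last by case: yL => [->|[b _ <-]]; rewrite /bullet ?heap_xxx ?id.
  by case: xL => [->|[b _ <-]]; rewrite /bullet ?heap_xxx ?id.
apply/eqmodP/asboolP; rewrite predeqE => z; split=> -[->|[a _ <-]].
- by right; exists x.
- by right; exists {[a, x, x]} => //; rewrite /bullet heapA -xy.
- by right; exists y.
- by right; exists {[a, y, y]} => //; rewrite /bullet heapA -yx.
Qed.

Lemma pE x y : p x = p y <-> forall z, {[x, x, z]} = {[y, y, z]}.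
Proof.
split=> [/pP[xy yx] z|xy]; last first.
  by apply/pP; split; rewrite -?xy ?heap_xxx // xy heap_xxx.
transitivity {[x, x, {[y, y, z]}]}.
  by rewrite heap_commL -heapA -xy.
by rewrite -heapA -yx.
Qed.

Lemma qE x y : q x = q y <-> forall z, {[z, x, x]} = {[z, y, y]}.
Proof.
split=> [/qP[xy yx] z|xy]; last first.
  by apply/qP; split; rewrite -?xy ?heap_xxx // xy heap_xxx.
transitivity {[z, x, {[x, y, y]}]}; first by rewrite -xy.
by rewrite heap_commR' -yx.
Qed.

Lemma qEw x y z u v : q x = q y ->
  {[z, x, {[x, u, v]}]} = {[z, y, {[y, u, v]}]}.
Proof. by move/qE => xy; rewrite -!heapA xy. Qed.

Lemma pEw x y z u v : p x = p y ->
  {[u, v, {[x, x, z]}]} = {[u, v, {[y, y, z]}]}.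
Proof. by move/pE => ->. Qed.

Lemma qEx x y w v : q x = q y -> {[x, y, {[y, w, v]}]} = {[x, w, v]}.
Proof. by case/qP => xy _; rewrite -heapA -xy. Qed.

Lemma qEx0 x y : q x = q y -> {[x, y, y]} = x.
Proof. by case/qP => <-. Qed.

Lemma pEx x y : p x = p y -> {[x, x, y]} = y.
Proof. by case/pP => _ <-. Qed.

Lemma heap_absr x y : {[x, y, {[y, x, x]}]} = {[x, y, y]}.
Proof. by rewrite heap_commR' heap_xxxl. Qed.

Lemma heap_absl x y : {[x, x, {[y, y, x]}]} = {[y, y, x]}.
Proof. by rewrite heap_commL heap_xxx. Qed.

(* The components of a fraction form a pair of the required kind. *)

Lemma q_mul x y u v : q x = q y -> q u = q v ->
  q {[x, y, u]} = q {[v, u, {[y, y, u]}]}.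
Proof.
move=> xy uv; apply/qE => z.
rewrite !(heapA, heapB) (qEw _ _ _ xy) heap_xxxl (qEx _ _ uv).
by rewrite heap_absl heap_idL.
Qed.

Lemma p_mul x y u v : p x = p y -> p u = p v ->
  p {[{[y, u, u]}, y, x]} = p {[y, u, v]}.
Proof.
move=> /pE xy /pE uv; apply/pE => z.
rewrite !(heapA, heapB) xy -uv !heap_xxxl.
by rewrite (heap_commM y u u) heap_xxxl heap_xxxr.
Qed.

Lemma q_bra x y : q {[x, y, y]} = q {[y, x, x]}.
Proof. by apply/qP; split; rewrite !(heapA, heapB) !heap_absr. Qed.

Lemma p_ket x y : p {[y, y, x]} = p {[x, x, y]}.
Proof. by apply/pP; split; rewrite !(heapA, heapB) !(heap_absl, heap_xxxl). Qed.
End Semilattices.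

Lemma partial_inverse_uniq (X : Type) (A B C : X -> X) :
  (forall z, A (B (A z)) = A z) -> (forall z, B (A (B z)) = B z) ->
  (forall z, A (C (A z)) = A z) -> (forall z, C (A (C z)) = C z) ->
  (forall z, A (B (A (C z))) = A (C (A (B z)))) ->
  (forall z, B (A (C (A z))) = C (A (B (A z)))) ->
  forall z, B z = C z.
Proof.
move=> ABA BAB ACA CAC ABC BCA z.
transitivity (C (A (B z))); first by rewrite -{1}BAB -{1}ACA BCA BAB.
by rewrite -[RHS]CAC -(ABA (C z)) ABC CAC.
Qed.

Lemma inverse_of_faithful (S : semigroupType) (X : Type) (inv : S -> S)
    (f : S -> X -> X) :
  (forall s t, f s =1 f t -> s = t) ->
  (forall s t z, f (s * t)%g z = f s (f t z)) \/
  (forall s t z, f (s * t)%g z = f t (f s z)) ->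
  (forall s z, f s (f (inv s) (f s z)) = f s z) ->
  (forall s z, f (inv s) (f s (f (inv s) z)) = f (inv s) z) ->
  (forall s t, (forall z, f s (f s z) = f s z) ->
     (forall z, f t (f t z) = f t z) -> forall z, f s (f t z) = f t (f s z)) ->
  forall s t : S, (s * t * s = s /\ t * s * t = t)%g <-> t = inv s.
Proof.
move=> inj fM fsVs fVsV fC s t; split=> [[sts tst]|->]; last first.
  by split; apply: inj => z; case: fM => fM; rewrite !fM.
have {}sts z : f s (f t (f s z)) = f s z.
  by rewrite -[in RHS]sts; case: fM => fM; rewrite !fM.
have {}tst z : f t (f s (f t z)) = f t z.
  by rewrite -[in RHS]tst; case: fM => fM; rewrite !fM.
have cM u v : exists w, forall z, f w z = f u (f v z).
  by case: fM => fM; [exists (u * v)%g | exists (v * u)%g].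
have C u v u' v' : (forall z, f u (f v (f u z)) = f u z) ->
    (forall z, f u' (f v' (f u' z)) = f u' z) ->
    forall z, f u (f v (f u' (f v' z))) = f u' (f v' (f u (f v z))).
  have [[w wE] [w' w'E]] := (cM u v, cM u' v') => uvu uvu' z.
  by rewrite -!(wE, w'E) fC // => y; rewrite !(wE, w'E) ?uvu ?uvu'.
by apply: inj; apply: (@partial_inverse_uniq _ (f s)) => // z; apply: C.
Qed.

Section FractionRelations.
Variable X : generalizedHeapType.
Implicit Types x y u v : X.

Definition qpair := {xy : X * X | q xy.1 = q xy.2}.
Definition ppair := {xy : X * X | p xy.1 = p xy.2}.
Definition QPair x y (xy : q x = q y) : qpair := exist _ (x, y) xy.
Definition PPair x y (xy : p x = p y) : ppair := exist _ (x, y) xy.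

Definition eqvr : rel {classic qpair} := fun a b =>
  let: (x, y) := sval a in let: (u, v) := sval b in
  `[< [/\ p x = p u, p y = p v & x = {[u, v, y]}] >].

Definition eqvl : rel {classic ppair} := fun a b =>
  let: (x, y) := sval a in let: (u, v) := sval b in
  `[< [/\ q x = q u, q y = q v & y = {[x, u, v]}] >].

Lemma qpair_opp x y u v : q x = q y -> q u = q v ->
  (forall z, {[x, y, z]} = {[u, v, z]}) ->
  forall z, {[y, x, z]} = {[v, u, z]}.
Proof.
move=> xy uv H.
have AB z : {[x, y, {[y, x, z]}]} = {[x, x, z]} by rewrite (qEx _ _ xy).
have BA z : {[y, x, {[x, y, z]}]} = {[y, y, z]} by rewrite qEx.
have AC z : {[x, y, {[v, u, z]}]} = {[u, u, z]} by rewrite H qEx.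
have CA z : {[v, u, {[x, y, z]}]} = {[v, v, z]} by rewrite H qEx.
apply: (@partial_inverse_uniq _ (fun z => {[x, y, z]})) => z.
- by rewrite AB heap_xxxl.
- by rewrite BA heap_xxxl.
- by rewrite AC H heap_xxxl.
- by rewrite CA heap_xxxl.
- by rewrite !(AB, AC) heap_commL.
- by rewrite !(BA, CA) heap_commL.
Qed.

Lemma eqvrP (a b : {classic qpair}) : 
  reflect (forall z, {[(sval a).1, (sval a).2, z]} =
                     {[(sval b).1, (sval b).2, z]}) (eqvr a b).
Proof.
case: a b => [[x y] /= xy] [[u v] /= uv]; apply/(iffP (asboolP _)).
  case=> xu yv xuvy z.
  by rewrite xuvy heapA (pEw _ _ _ yv) heap_xxxr.
move=> H; have H' := qpair_opp xy uv H; split.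
- by apply/pE => z; rewrite -(qEx _ _ xy) H H' qEx.
- by apply/pE => z; rewrite -(qEx _ _ (esym xy)) H H' qEx.
- by rewrite -H qEx0.
Qed.

Lemma ppair_opp x y u v : p x = p y -> p u = p v ->
  (forall z, {[z, x, y]} = {[z, u, v]}) ->
  forall z, {[z, y, x]} = {[z, v, u]}.
Proof.
move=> xy uv H.
have E (a b : X) (ab : p a = p b) z : {[{[z, a, b]}, b, a]} = {[z, a, a]}.
  by rewrite heapA (pEx (x := b)).
have AB z : {[{[z, x, y]}, y, x]} = {[z, x, x]} by exact: E.
have BA z : {[{[z, y, x]}, x, y]} = {[z, y, y]} by exact: E.
have AC z : {[{[z, x, y]}, v, u]} = {[z, u, u]} by rewrite H E.
have CA z : {[{[z, v, u]}, x, y]} = {[z, v, v]} by rewrite H E.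
have id (z a b : X) : {[{[z, a, a]}, a, b]} = {[z, a, b]}.
  by rewrite heapA heap_xxxr.
apply: (@partial_inverse_uniq _ (fun z => {[z, x, y]})) => z.
- by rewrite AB id.
- by rewrite BA id.
- by rewrite AC H id.
- by rewrite CA id.
- by rewrite !(BA, CA) heap_commR.
- by rewrite !(AB, AC) heap_commR.
Qed.

Lemma eqvlP (a b : {classic ppair}) :
  reflect (forall z, {[z, (sval a).1, (sval a).2]} =
                     {[z, (sval b).1, (sval b).2]}) (eqvl a b).
Proof.
case: a b => [[x y] /= xy] [[u v] /= uv]; apply/(iffP (asboolP _)).
  case=> xu yv yxuv z.
  by rewrite yxuv (qEw _ _ _ xu) heap_xxxr.
move=> H; have H' := ppair_opp xy uv H.
have E (a b : X) (ab : p a = p b) z : {[{[z, a, b]}, b, a]} = {[z, a, a]}.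
  by rewrite heapA (pEx (x := b)).
split.
- by apply/qE => z; rewrite -(E _ _ xy) H H' E.
- by apply/qE => z; rewrite -(E _ _ (esym xy)) H H' E.
- by rewrite -H pEx.
Qed.

Lemma eqvr_refl : reflexive eqvr. Proof. by move=> a; apply/eqvrP. Qed.
Lemma eqvr_sym : symmetric eqvr.
Proof. by move=> a b; apply/eqvrP/eqvrP => H z. Qed.
Lemma eqvr_trans : transitive eqvr.
Proof.
by move=> b a c /eqvrP ab /eqvrP bc; apply/eqvrP => z; rewrite ab.
Qed.
Canonical eqvr_equiv := EquivRel eqvr eqvr_refl eqvr_sym eqvr_trans.

Lemma eqvl_refl : reflexive eqvl. Proof. by move=> a; apply/eqvlP. Qed.
Lemma eqvl_sym : symmetric eqvl.
Proof. by move=> a b; apply/eqvlP/eqvlP => H z. Qed.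
Lemma eqvl_trans : transitive eqvl.
Proof.
by move=> b a c /eqvlP ab /eqvlP bc; apply/eqvlP => z; rewrite ab.
Qed.
Canonical eqvl_equiv := EquivRel eqvl eqvl_refl eqvl_sym eqvl_trans.

(* [XXV] is $XX^{-1}$, [XVX] is $X^{-1}X$. *)
Definition XXV := {eq_quot eqvr_equiv}.
Definition XVX := {eq_quot eqvl_equiv}.
HB.instance Definition _ := EqQuotient.on XXV.
HB.instance Definition _ := Choice.on XXV.
HB.instance Definition _ := EqQuotient.on XVX.
HB.instance Definition _ := Choice.on XVX.

(* The class of a pair: $xy^{-1}$ and $x^{-1}y$ respectively. *)
Definition fracr x y (xy : q x = q y) : XXV :=
  \pi_XXV (QPair xy : {classic qpair}).
Definition fracl x y (xy : p x = p y) : XVX :=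
  \pi_XVX (PPair xy : {classic ppair}).

Arguments fracr x y xy : clear implicits.
Arguments fracl x y xy : clear implicits.

Definition mul_qpair (a b : {classic qpair}) : {classic qpair} :=
  let: exist (x, y) xy := a in let: exist (u, v) uv := b in
  @QPair {[x, y, u]} {[v, u, {[y, y, u]}]} (q_mul xy uv).
Definition mul_ppair (a b : {classic ppair}) : {classic ppair} :=
  let: exist (x, y) xy := a in let: exist (u, v) uv := b in
  @PPair {[{[y, u, u]}, y, x]} {[y, u, v]} (p_mul xy uv).
Definition opp_qpair (a : {classic qpair}) : {classic qpair} :=
  let: exist (x, y) xy := a in @QPair y x (esym xy).
Definition opp_ppair (a : {classic ppair}) : {classic ppair} :=
  let: exist (x, y) xy := a in @PPair y x (esym xy).

(* These operations compute on chosen representatives; lemmas [mulXXV_pi] to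
   [invXVX_pi] show that the choice does not matter. *)
Definition mulXXV : XXV -> XXV -> XXV := lift_op2 XXV mul_qpair.
Definition mulXVX : XVX -> XVX -> XVX := lift_op2 XVX mul_ppair.
Definition invXXV : XXV -> XXV := lift_op1 XXV opp_qpair.
Definition invXVX : XVX -> XVX := lift_op1 XVX opp_ppair.

Definition act_qpair (a : {classic qpair}) (z : X) : X :=
  {[(sval a).1, (sval a).2, z]}.
Definition act_ppair (a : {classic ppair}) (z : X) : X :=
  {[z, (sval a).1, (sval a).2]}.

Lemma fracr_eqP a b : reflect (act_qpair a =1 act_qpair b)
  (\pi_XXV a == \pi_XXV b).
Proof. by rewrite eqmodE; apply: eqvrP. Qed.

Lemma fracl_eqP a b : reflect (act_ppair a =1 act_ppair b)
  (\pi_XVX a == \pi_XVX b).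
Proof. by rewrite eqmodE; apply: eqvlP. Qed.

Lemma actr_mul a b z :
  act_qpair (mul_qpair a b) z = act_qpair a (act_qpair b z).
Proof.
case: a b => [[x y] /= xy] [[u v] /= uv]; rewrite /act_qpair /=.
rewrite !(heapA, heapB) heap_commL.
by rewrite !heap_xxxl heap_xxxr.
Qed.

Lemma actl_mul a b z :
  act_ppair (mul_ppair a b) z = act_ppair b (act_ppair a z).
Proof.
case: a b => [[x y] /= xy] [[u v] /= uv]; rewrite /act_ppair /=.
by rewrite !(heapA, heapB) (heap_commM u y y) heap_xxxl heap_xxxr.
Qed.

Lemma actr_opp a b : act_qpair a =1 act_qpair b ->
  act_qpair (opp_qpair a) =1 act_qpair (opp_qpair b).
Proof. by case: a b => [[x y] xy] [[u v] uv]; apply: qpair_opp. Qed.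

Lemma actr_repr a : act_qpair (repr (\pi_XXV a)) =1 act_qpair a.
Proof. by apply/fracr_eqP; rewrite reprK. Qed.

Lemma actl_opp a b : act_ppair a =1 act_ppair b ->
  act_ppair (opp_ppair a) =1 act_ppair (opp_ppair b).
Proof. by case: a b => [[x y] xy] [[u v] uv]; apply: ppair_opp. Qed.

Lemma actl_repr a : act_ppair (repr (\pi_XVX a)) =1 act_ppair a.
Proof. by apply/fracl_eqP; rewrite reprK. Qed.

Lemma mulXXV_pi a b : mulXXV (\pi_XXV a) (\pi_XXV b) = \pi_XXV (mul_qpair a b).
Proof.
unlock mulXXV; apply/eqP/fracr_eqP => z.
by rewrite !actr_mul !actr_repr.
Qed.

Lemma mulXVX_pi a b : mulXVX (\pi_XVX a) (\pi_XVX b) = \pi_XVX (mul_ppair a b).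
Proof.
unlock mulXVX; apply/eqP/fracl_eqP => z.
by rewrite !actl_mul !actl_repr.
Qed.

Lemma invXXV_pi a : invXXV (\pi_XXV a) = \pi_XXV (opp_qpair a).
Proof.
unlock invXXV; apply/eqP/fracr_eqP; exact/actr_opp/actr_repr.
Qed.

Lemma invXVX_pi a : invXVX (\pi_XVX a) = \pi_XVX (opp_ppair a).
Proof.
unlock invXVX; apply/eqP/fracl_eqP; exact/actl_opp/actl_repr.
Qed.

Lemma mulXXVA : associative mulXXV.
Proof.
elim/quotW => a; elim/quotW => b; elim/quotW => c.
by rewrite !mulXXV_pi; apply/eqP/fracr_eqP => z; rewrite !actr_mul.
Qed.

Lemma mulXVXA : associative mulXVX.
Proof.
elim/quotW => a; elim/quotW => b; elim/quotW => c.
by rewrite !mulXVX_pi; apply/eqP/fracl_eqP => z; rewrite !actl_mul.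
Qed.

HB.instance Definition _ := isSemigroup.Build XXV mulXXVA.
HB.instance Definition _ := isSemigroup.Build XVX mulXVXA.

Lemma actr_idem a : (forall z, act_qpair a (act_qpair a z) = act_qpair a z) ->
  forall z, act_qpair a z =
    {[(sval a).1, (sval a).1, {[(sval a).2, (sval a).2, z]}]}.
Proof.
case: a => [[x y] /= xy] H z; rewrite /act_qpair /= in H *.
have yyx : {[y, y, x]} = y.
  have := congr1 (heap_op y x) (H y).
  by rewrite (qEx0 xy) (qEx0 (esym xy)) qEx.
by rewrite -[in LHS]yyx heapB.
Qed.

Lemma invXXVP (s t : XXV) : (s * t * s = s /\ t * s * t = t)%g <-> t = invXXV s.
Proof.
apply: (@inverse_of_faithful XXV X invXXV (fun s => act_qpair (repr s))).
- by move=> a b ab; rewrite -[a]reprK -[b]reprK; apply/eqP/fracr_eqP.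
- left; elim/quotW => a; elim/quotW => b z.
  by rewrite [(_ * _)%g]mulXXV_pi !actr_repr actr_mul.
- elim/quotW => -[[x y] /= xy] z; rewrite invXXV_pi !actr_repr.
  by rewrite /act_qpair /= qEx // heap_xxxl.
- elim/quotW => -[[x y] /= xy] z; rewrite invXXV_pi !actr_repr.
  by rewrite /act_qpair /= qEx // heap_xxxl.
- move=> a b /actr_idem aE /actr_idem bE z; rewrite !aE !bE.
exact: heap_commLL.
Qed.

Lemma actl_idem a : (forall z, act_ppair a (act_ppair a z) = act_ppair a z) ->
  forall z, act_ppair a z =
    {[{[z, (sval a).1, (sval a).1]}, (sval a).2, (sval a).2]}.
Proof.
case: a => [[x y] /= xy] H z; rewrite /act_ppair /= in H *.
have yxx : {[y, x, x]} = x.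
  have := congr1 (fun t => {[t, y, x]}) (H x).
  by rewrite (pEx xy) !heapA (pEx (esym xy)).
by rewrite -[in LHS]yxx heapB heapA.
Qed.

Lemma invXVXP (s t : XVX) : (s * t * s = s /\ t * s * t = t)%g <-> t = invXVX s.
Proof.
have E (a b : X) (ab : p a = p b) z : {[{[{[z, a, b]}, b, a]}, a, b]} = {[z, a, b]}.
  by rewrite !heapA (pEx ab) heap_xxx.
apply: (@inverse_of_faithful XVX X invXVX (fun s => act_ppair (repr s))).
- by move=> a b ab; rewrite -[a]reprK -[b]reprK; apply/eqP/fracl_eqP.
- right; elim/quotW => a; elim/quotW => b z.
  by rewrite [(_ * _)%g]mulXVX_pi !actl_repr actl_mul.
- by elim/quotW => -[[x y] /= xy] z; rewrite invXVX_pi !actl_repr; apply: E.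
- by elim/quotW => -[[x y] /= xy] z; rewrite invXVX_pi !actl_repr; apply: E.
- move=> a b /actl_idem aE /actl_idem bE z; rewrite !aE !bE.
  exact: heap_commRR.
Qed.

HB.instance Definition _ := Semigroup_isInverse.Build XXV invXXVP.
HB.instance Definition _ := Semigroup_isInverse.Build XVX invXVXP.

Lemma fracr_mul x y u v (xy : q x = q y) (uv : q u = q v) :
  (fracr x y xy * fracr u v uv)%g =
  fracr {[x, y, u]} {[v, u, {[y, y, u]}]} (q_mul xy uv).
Proof. by rewrite [LHS]mulXXV_pi. Qed.

Lemma fracl_mul x y u v (xy : p x = p y) (uv : p u = p v) :
  (fracl x y xy * fracl u v uv)%g =
  fracl {[{[y, u, u]}, y, x]} {[y, u, v]} (p_mul xy uv).
Proof. by rewrite [LHS]mulXVX_pi. Qed.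

Lemma fracr_inv x y (xy : q x = q y) : sinv (fracr x y xy) = fracr y x (esym xy).
Proof. by rewrite [LHS]invXXV_pi. Qed.

Lemma fracl_inv x y (xy : p x = p y) : sinv (fracl x y xy) = fracl y x (esym xy).
Proof. by rewrite [LHS]invXVX_pi. Qed.

End FractionRelations.

Arguments fracr {X} x y xy.
Arguments fracl {X} x y xy.

(* Main.v *)
Require Import Defs.
From mathcomp Require Import all_boot.
From mathcomp Require Import generic_quotient monoid.

(** Two pairs represent the same fraction exactly when they induce the same
    transformation of [X], namely [z |-> {[x, y, z]}] for [fracr x y] and
    [z |-> {[z, x, y]}] for [fracl x y].  Both actions are therefore well
    defined and faithful; the products of fractions are made to be composites
    of these maps, and the two actions commute by associativity of the heap
    operation.

    The brackets extend this dictionary to all pairs: [heap_bra x y] acts as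
    [z |-> {[x, y, z]}] and [heap_ket x y] as [z |-> {[z, x, y]}], for
    arbitrary [x] and [y] (lemmas [bra_act] and [ket_act]).  Passing from
    [x, y] to [{[x, y, y]}, {[y, x, x]}] only serves to obtain a pair with equal
    images under [q] without changing the transformation, and likewise for
    the ket and [p].  Hence the two sides of the exchange law between the
    brackets are both [{[x, y, z]}], the unit laws are idempotency, and
    linearity of the brackets becomes, by faithfulness, associativity of the
    heap operation.  The brackets are surjective because [heap_bra x y] and
    [fracr x y] act alike whenever the latter exists. *)

Section FractionActions.
Variable X : generalizedHeapType.
Implicit Types (x y z : X) (s : XXV X) (t : XVX X).

Local Open Scope quotient_scope.

Definition XXV_act s z : X := act_qpair (repr s) z.
Definition XVX_act z t : X := act_ppair (repr t) z.

Definition heap_bra x y : XXV X := fracr {[x, y, y]} {[y, x, x]} (q_bra x y).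
Definition heap_ket x y : XVX X := fracl {[y, y, x]} {[x, x, y]} (p_ket x y).

Lemma XXV_act_fracr x y (xy : q x = q y) z :
  XXV_act (fracr x y xy) z = {[x, y, z]}.
Proof. by rewrite /XXV_act actr_repr. Qed.

Lemma XVX_act_fracl x y (xy : p x = p y) z :
  XVX_act z (fracl x y xy) = {[z, x, y]}.
Proof. by rewrite /XVX_act actl_repr. Qed.

Lemma XXV_act_faithful s1 s2 : XXV_act s1 =1 XXV_act s2 -> s1 = s2.
Proof. by move=> E; rewrite -[s1]reprK -[s2]reprK; apply/eqP/fracr_eqP. Qed.

Lemma XVX_act_faithful t1 t2 : XVX_act^~ t1 =1 XVX_act^~ t2 -> t1 = t2.
Proof. by move=> E; rewrite -[t1]reprK -[t2]reprK; apply/eqP/fracl_eqP. Qed.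

Lemma XXV_fracrP s : exists x y (xy : q x = q y), s = fracr x y xy.
Proof. by elim/quotW: s => -[[x y] xy]; exists x, y, xy. Qed.

Lemma XVX_fraclP t : exists x y (xy : p x = p y), t = fracl x y xy.
Proof. by elim/quotW: t => -[[x y] xy]; exists x, y, xy. Qed.

Lemma XXV_actM s1 s2 z : XXV_act (s1 * s2)%g z = XXV_act s1 (XXV_act s2 z).
Proof.
elim/quotW: s1 => a; elim/quotW: s2 => b.
by rewrite [(_ * _)%g]mulXXV_pi /XXV_act !actr_repr actr_mul.
Qed.

Lemma XVX_actM z t1 t2 : XVX_act z (t1 * t2)%g = XVX_act (XVX_act z t1) t2.
Proof.
elim/quotW: t1 => a; elim/quotW: t2 => b.
by rewrite [(_ * _)%g]mulXVX_pi /XVX_act !actl_repr actl_mul.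
Qed.

(** By associativity the left side is [{[x, y, {[y, x, {[x, y, z]}]}]}]; the
    maps [A := {[x, y, -]}] and [B := {[y, x, -]}] satisfy [A B A = A] even
    when [x] and [y] do not form a fraction, because the idempotent maps
    [{[-, x, x]}] and [{[-, y, y]}] commute. *)
Lemma bra_act x y z : XXV_act (heap_bra x y) z = {[x, y, z]}.
Proof.
by rewrite XXV_act_fracr !(heapA, heapB) heap_commM heap_xxxr heap_xxxl.
Qed.

Lemma ket_act x y z : XVX_act z (heap_ket x y) = {[z, x, y]}.
Proof. by rewrite XVX_act_fracl heapB heap_commL heap_xxx heap_xxxr. Qed.

Lemma XXV_actA s x y z : {[XXV_act s x, y, z]} = XXV_act s {[x, y, z]}.
Proof. exact: heapA. Qed.

Lemma XVX_actA x y z t : XVX_act {[x, y, z]} t = {[x, y, XVX_act z t]}.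
Proof. exact: heapA. Qed.

Lemma XXV_XVX_act_comm s x t : XVX_act (XXV_act s x) t = XXV_act s (XVX_act x t).
Proof. exact: heapA. Qed.

Lemma bra_surj s : exists x y, heap_bra x y = s.
Proof.
have [x [y [xy ->]]] := XXV_fracrP s; exists x, y.
by apply: XXV_act_faithful => z; rewrite bra_act XXV_act_fracr.
Qed.

Lemma ket_surj t : exists x y, heap_ket x y = t.
Proof.
have [x [y [xy ->]]] := XVX_fraclP t; exists x, y.
by apply: XVX_act_faithful => z; rewrite ket_act XVX_act_fracl.
Qed.

Lemma bra_sinv x y : heap_bra y x = sinv (heap_bra x y).
Proof.
by apply: XXV_act_faithful => z; rewrite fracr_inv !XXV_act_fracr.
Qed.

Lemma ket_sinv x y : heap_ket x y = sinv (heap_ket y x).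
Proof.
by apply: XVX_act_faithful => z; rewrite fracl_inv !XVX_act_fracl.
Qed.

Lemma fraction_bimodule : bimodule XXV_act XVX_act.
Proof.
split; last exact: XXV_XVX_act_comm.
- split=> [|x]; first exact: XXV_actM.
  by exists (heap_bra x x), x; rewrite bra_act heap_xxx.
- split=> [|x]; first by move=> *; exact: XVX_actM.
  by exists x, (heap_ket x x); rewrite ket_act heap_xxx.
Qed.

Lemma fraction_equivalence_bimodule :
  equivalence_bimodule XXV_act XVX_act heap_bra heap_ket.
Proof.
split.
- exact: fraction_bimodule.
- exact: bra_surj.
- exact: ket_surj.
- move=> s x y; apply: XXV_act_faithful => z.
  by rewrite XXV_actM !bra_act XXV_actA.
- exact: bra_sinv.
- by move=> x; rewrite bra_act heap_xxx.
- move=> x y t; apply: XVX_act_faithful => z.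
  by rewrite XVX_actM !ket_act XVX_actA.
- exact: ket_sinv.
- by move=> x; rewrite ket_act heap_xxx.
- by move=> x y z; rewrite bra_act ket_act.
Qed.

End FractionActions.

Theorem theorem3p9 (X : generalizedHeapType) :
  exists (actl : XXV X -> X -> X) (actr : X -> XVX X -> X)
         (bra : X -> X -> XXV X) (ket : X -> X -> XVX X),
  [/\ forall (x y z : X) (xy : q x = q y),
        actl (fracr x y xy) z = {[x, y, z]},
      forall (x y z : X) (yz : p y = p z),
        actr x (fracl y z yz) = {[x, y, z]},
      forall x y : X, bra x y = fracr {[x, y, y]} {[y, x, x]} (q_bra x y),
      forall x y : X, ket x y = fracl {[y, y, x]} {[x, x, y]} (p_ket x y)
    & equivalence_bimodule actl actr bra ket].
Proof.
exists (@XXV_act X), (@XVX_act X), (@heap_bra X), (@heap_ket X); split=> //.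
- by move=> x y z xy; exact: XXV_act_fracr.
- by move=> x y z yz; exact: XVX_act_fracl.
- exact: fraction_equivalence_bimodule.
Qed.
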